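(* For every positive integer $n$, $a(n)\ge 0$, with equality if and only if $n=1$ or $n=2$.
   Context: For a positive integer $n$, $a(n)$ is the signed number of partitions of $n$ into exactly two distinct part sizes, each occurring an odd number of times: $$a(n)=\sum (-1)^{r_1+r_2},$$ the sum being over all quadruples of integers $(x,y,r_1,r_2)$ with $1\le x<y$, $r_1,r_2\ge 0$ and $(2r_1+1)x+(2r_2+1)y=n$. *)

(* Defs.v *)
From mathcomp Require Import all_boot all_order all_algebra.
From mathcomp Require Import zify.
Set Implicit Arguments.
Unset Strict Implicit.
Unset Printing Implicit Defensive.

(* The part sizes are x < y, with odd multiplicities 2 r1 + 1 and 2 r2 + 1. *)
Definition odd_two_size_partition (n x y r1 r2 : nat) : bool :=
  [&& 0 < x, x < y & (2 * r1 + 1) * x + (2 * r2 + 1) * y == n].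

(* The sum is made finite by bounding every index by n, which excludes no
   solution (odd_two_size_partition_bounded). *)
Definition a (n : nat) : int :=
  (\sum_(x < n.+1) \sum_(y < n.+1) \sum_(r1 < n.+1)
     \sum_(r2 < n.+1 | odd_two_size_partition n x y r1 r2)
       (-1) ^+ (r1 + r2)%N)%R.

Lemma odd_two_size_partition_bounded (n x y r1 r2 : nat) :
  odd_two_size_partition n x y r1 r2 ->
  [/\ x < n.+1, y < n.+1, r1 < n.+1 & r2 < n.+1].
Proof. by case/and3P=> x_gt0 lt_xy /eqP def_n; split; nia. Qed.

(* Main.v *)
Require Import Defs.
From mathcomp Require Import all_boot all_order all_algebra.
From mathcomp Require Import zify.

Set Implicit Arguments.
Unset Strict Implicit.
Unset Printing Implicit Defensive.

Import Order.TTheory GRing.Theory Num.Theory.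

(* Write cos4 k = cos (k pi / 2) and sin4 k = sin (k pi / 2).  Then a(n) is the
   sum of sin4 a * sin4 b over the solutions of a x + b y = n with x < y, and
   2 sin4 a sin4 b = cos4 (a - b) - cos4 (a + b).  The Liouville bijections
     (a, b, x, y) -> (a - b, b, x, x + y)   (a > b  to  x < y),
     (a, b, x, y) -> (a + b, b, x, y - x)   (x < y  to  a > b),
     (a, b, x, y) -> (a, a + b, x - y, y)   (x > y  to  a < b)
   cancel everything but the diagonals a = b and x = y, which leaves
     4 a(n) = sum_(d | n) ((n / d) (1 + 2 cos4 d) - sin4 d).
   Pairing each odd divisor d with 2 d when n is even makes all contributions
   nonnegative, the one of d = 1 being positive as soon as n > 2. *)

(** * Integer-valued cosine and sine at multiples of pi / 2 *)

Definition cos4 (k : nat) : int :=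
  match (k %% 4)%N with 0 => 1%R | 2 => (-1)%R | _ => 0%R end.

Definition sin4 (k : nat) : int :=
  match (k %% 4)%N with 1 => 1%R | 3 => (-1)%R | _ => 0%R end.

Lemma cos4_sub_add (b c : nat) :
  (2 * (sin4 (b + c) * sin4 b) = cos4 c - cos4 (b + c + b))%R.
Proof.
rewrite /sin4 /cos4.
have -> : (b + c) %% 4 = (b %% 4 + c %% 4) %% 4 by lia.
have -> : (b + c + b) %% 4 = (b %% 4 + c %% 4 + b %% 4) %% 4 by lia.
have := ltn_pmod b (isT : 0 < 4); have := ltn_pmod c (isT : 0 < 4).
by case: (b %% 4) => [|[|[|[|]]]] //; case: (c %% 4) => [|[|[|[|]]]].
Qed.

(** One of the two truncated differences is 0, so the argument is |a - b|; this loses nothing, as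
    cosine is even. *)
Definition cos4_diff (a b : nat) : int := cos4 ((a - b) + (b - a)).

Lemma cos4_diff_add (a b : nat) :
  (2 * (sin4 a * sin4 b) = cos4_diff a b - cos4 (a + b))%R.
Proof.
rewrite /cos4_diff; case: (leqP b a) => [le_ba | lt_ab].
  have := cos4_sub_add b (a - b); rewrite subnKC // => ->.
  by congr (cos4 _ - cos4 _)%R; lia.
have := cos4_sub_add a (b - a); rewrite subnKC 1?ltnW // mulrC.
rewrite (mulrC (sin4 b)) mulrC => ->.
by congr (cos4 _ - cos4 _)%R; lia.
Qed.

Lemma sin4_double_odd (k : nat) : sin4 (2 * k + 1) = ((-1) ^+ k)%R.
Proof.
have -> : ((-1) ^+ k = (-1) ^+ (odd k) :> int)%R by rewrite signr_odd.
have [r] : exists r, k = r.*2 + odd k by exists k./2; lia.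
rewrite /sin4; case: (odd k) => ->.
  by have -> : (2 * (r.*2 + true) + 1) %% 4 = 3 by lia.
by have -> : (2 * (r.*2 + false) + 1) %% 4 = 1 by lia.
Qed.

Lemma sin4_even (k : nat) : ~~ odd k -> sin4 k = 0%R.
Proof.
move=> even_k; rewrite /sin4.
by have [->|->] : k %% 4 = 0 \/ k %% 4 = 2 by lia.
Qed.

Lemma sin4_le1 (k : nat) : (sin4 k <= 1)%R.
Proof. by rewrite /sin4; case: (k %% 4) => [|[|[|[|]]]]. Qed.

Lemma cos4_odd (k : nat) : odd k -> cos4 k = 0%R.
Proof.
move=> odd_k; rewrite /cos4.
by have [->|->] : k %% 4 = 1 \/ k %% 4 = 3 by lia.
Qed.

(** * Reindexing sums over the positive solutions of a x + b y = n *)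

Lemma big_seq_bij (T1 T2 : eqType) (s1 : seq T1) (s2 : seq T2)
    (h : T1 -> T2) (g : T2 -> T1) (F : T2 -> int) :
    uniq s1 -> uniq s2 ->
    {in s1, forall t, h t \in s2 /\ g (h t) = t} ->
    {in s2, forall t, g t \in s1 /\ h (g t) = t} ->
  (\sum_(t <- s1) F (h t) = \sum_(t <- s2) F t)%R.
Proof.
move=> uniq1 uniq2 hP gP; rewrite -(big_map h predT F); apply: perm_big.
apply: uniq_perm => // [|t].
  rewrite map_inj_in_uniq // => t u t1 u1 eq_tu.
  by rewrite -(hP t t1).2 -(hP u u1).2 eq_tu.
apply/mapP/idP => [[u u1 ->] | t2]; first by case: (hP u u1).
by have [gt1 <-] := gP t t2; exists (g t); rewrite ?(gP t t2).2.
Qed.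

Definition quad : Type := (nat * nat * nat * nat)%type.

Definition box (N : nat) : seq quad :=
  [seq (nat_of_ord t.1.1.1, nat_of_ord t.1.1.2, nat_of_ord t.1.2,
        nat_of_ord t.2)
    | t <- enum {: 'I_N * 'I_N * 'I_N * 'I_N}].

Lemma box_uniq (N : nat) : uniq (box N).
Proof.
rewrite map_inj_uniq ?enum_uniq // => [[[[a b] x] y] [[[a' b'] x'] y']] /=.
by case=> /val_inj -> /val_inj -> /val_inj -> /val_inj ->.
Qed.

Lemma mem_box (N a b x y : nat) :
  ((a, b, x, y) \in box N) = [&& a < N, b < N, x < N & y < N].
Proof.
apply/mapP/and4P => [[[[[a' b'] x'] y'] _ [-> -> -> ->]] // | [aN bN xN yN]].
by exists (Ordinal aN, Ordinal bN, Ordinal xN, Ordinal yN); rewrite ?mem_enum.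
Qed.

Definition sol (n : nat) (t : quad) : bool :=
  let: (a, b, x, y) := t in
  [&& 0 < a, 0 < b, 0 < x, 0 < y & a * x + b * y == n].

Definition sols (n : nat) : seq quad := [seq t <- box n.+1 | sol n t].

Lemma sols_uniq (n : nat) : uniq (sols n).
Proof. exact/filter_uniq/box_uniq. Qed.

(** With all four entries positive, a x + b y = n already bounds each of them by n, so the box cuts
    off nothing. *)
Lemma mem_sols (n : nat) (t : quad) : (t \in sols n) = sol n t.
Proof.
rewrite mem_filter; case: t => [[[a b] x] y]; rewrite mem_box andb_idr //=.
by case/and5P=> a0 b0 x0 y0 /eqP def_n; apply/and4P; split; nia.
Qed.

Lemma mem_filter_sols (n : nat) (P : pred quad) (t : quad) :
  (t \in [seq u <- sols n | P u]) = P t && sol n t.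
Proof. by rewrite mem_filter mem_sols. Qed.

Definition qa (t : quad) := t.1.1.1.
Definition qb (t : quad) := t.1.1.2.
Definition qx (t : quad) := t.1.2.
Definition qy (t : quad) := t.2.

Lemma sum_sols_bij (n : nat) (P Q : pred quad) (h g : quad -> quad)
    (F : quad -> int) :
    (forall t, sol n t -> P t -> [/\ sol n (h t), Q (h t) & g (h t) = t]) ->
    (forall t, sol n t -> Q t -> [/\ sol n (g t), P (g t) & h (g t) = t]) ->
  (\sum_(t <- sols n | P t) F (h t) = \sum_(t <- sols n | Q t) F t)%R.
Proof.
move=> hP gP; rewrite -[LHS]big_filter -[RHS]big_filter.
apply: (big_seq_bij (g := g)).
- exact/filter_uniq/sols_uniq.
- exact/filter_uniq/sols_uniq.
- move=> t; rewrite !mem_filter_sols => /andP[Pt st].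
  by have [-> -> ->] := hP t st Pt.
- move=> t; rewrite !mem_filter_sols => /andP[Qt st].
  by have [-> -> ->] := gP t st Qt.
Qed.

Definition qswap (t : quad) : quad :=
  let: (a, b, x, y) := t in (b, a, y, x).

Lemma sum_sols_swap (n : nat) (P : pred quad) (F : quad -> int) :
  (\sum_(t <- sols n | P (qswap t)) F (qswap t) =
   \sum_(t <- sols n | P t) F t)%R.
Proof.
apply: (sum_sols_bij (g := qswap)) => -[[[a b] x] y] /= /and5P[-> -> -> -> st];
  by rewrite addnC st.
Qed.

(** * The Liouville bijections *)

(** Rests on a x + b y = (a - b) x + b (x + y). *)
Lemma liouville_sub (n : nat) (f : nat -> int) :
  (\sum_(t <- sols n | (qb t < qa t)%N) f (qa t - qb t)%N =
   \sum_(t <- sols n | (qx t < qy t)%N) f (qa t))%R.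
Proof.
rewrite -(@sum_sols_bij n (fun t => qb t < qa t) (fun t => qx t < qy t)
  (fun t => (qa t - qb t, qb t, qx t, qx t + qy t))
  (fun t => (qa t + qb t, qb t, qx t, qy t - qx t)) (fun t => f (qa t))) //;
  move=> [[[a b] x] y] /and5P[a0 b0 x0 y0 /eqP <-]; rewrite /qa /qb /qx /qy /=
    => lt_; split.
- by apply/and5P; split=> //; [lia.. | apply/eqP; nia].
- lia.
- by congr (_, _, _, _); lia.
- by apply/and5P; split=> //; [lia.. | apply/eqP; nia].
- lia.
- by congr (_, _, _, _); lia.
Qed.

(** The inverse substitution, a x + b y = (a + b) x + b (y - x), used to remove sums of the
    coefficients. *)
Lemma liouville_add (n : nat) (f : nat -> int) :
  (\sum_(t <- sols n | (qx t < qy t)%N) f (qa t + qb t)%N =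
   \sum_(t <- sols n | (qb t < qa t)%N) f (qa t))%R.
Proof.
rewrite -(@sum_sols_bij n (fun t => qx t < qy t) (fun t => qb t < qa t)
  (fun t => (qa t + qb t, qb t, qx t, qy t - qx t))
  (fun t => (qa t - qb t, qb t, qx t, qx t + qy t)) (fun t => f (qa t))) //;
  move=> [[[a b] x] y] /and5P[a0 b0 x0 y0 /eqP <-]; rewrite /qa /qb /qx /qy /=
    => lt_; split.
- by apply/and5P; split=> //; [lia.. | apply/eqP; nia].
- lia.
- by congr (_, _, _, _); lia.
- by apply/and5P; split=> //; [lia.. | apply/eqP; nia].
- lia.
- by congr (_, _, _, _); lia.
Qed.

(** Here a x + b y = a (x - y) + (a + b) y keeps a fixed, so an order condition on x, y becomes one
    on a, b without changing the summand. *)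
Lemma liouville_shear (n : nat) (f : nat -> int) :
  (\sum_(t <- sols n | (qy t < qx t)%N) f (qa t) =
   \sum_(t <- sols n | (qa t < qb t)%N) f (qa t))%R.
Proof.
rewrite -(@sum_sols_bij n (fun t => qy t < qx t) (fun t => qa t < qb t)
  (fun t => (qa t, qa t + qb t, qx t - qy t, qy t))
  (fun t => (qa t, qb t - qa t, qx t + qy t, qy t)) (fun t => f (qa t))) //;
  move=> [[[a b] x] y] /and5P[a0 b0 x0 y0 /eqP <-]; rewrite /qa /qb /qx /qy /=
    => lt_; split.
- by apply/and5P; split=> //; [lia.. | apply/eqP; nia].
- lia.
- by congr (_, _, _, _); lia.
- by apply/and5P; split=> //; [lia.. | apply/eqP; nia].
- lia.
- by congr (_, _, _, _); lia.
Qed.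

Lemma sum_trichotomy (s : seq quad) (u v : quad -> nat) (F : quad -> int) :
  (\sum_(t <- s) F t = \sum_(t <- s | u t == v t) F t
    + \sum_(t <- s | (u t < v t)%N) F t + \sum_(t <- s | (v t < u t)%N) F t)%R.
Proof.
rewrite (bigID (fun t => u t == v t)) /= -addrA; congr (_ + _)%R.
rewrite (bigID (fun t => (u t < v t)%N)) /=.
by congr (_ + _)%R; apply: eq_bigl => t; lia.
Qed.

(** * Reduction of a(n) to the diagonals a = b and x = y *)

(** The coefficients are the multiplicities 2 r + 1, whose sign is their [sin4]; solutions with an
    even coefficient contribute 0. *)
Lemma a_sum_sols (n : nat) :
  a n = (\sum_(t <- sols n | (qx t < qy t)%N) sin4 (qa t) * sin4 (qb t))%R.
Proof.
(* In [F], [P] and the source of [h] a quadruple means (x, y, r1, r2), so [qa], [qb] read part sizes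
   and [qx], [qy] read r1, r2. *)
pose F (t : quad) : int := ((-1) ^+ (qx t + qy t)%N)%R.
pose P (t : quad) := odd_two_size_partition n (qa t) (qb t) (qx t) (qy t).
have -> : a n = (\sum_(t <- [seq t <- box n.+1 | P t]) F t)%R.
  rewrite big_filter big_map big_enum_cond /a /= !pair_big_dep /=.
  by apply: eq_bigl => -[[[x y] r1] r2].
rewrite [RHS](bigID (fun t => odd (qa t) && odd (qb t))) /=.
rewrite [X in (_ + X)%R]big1.
  2: by move=> t /andP[_]; rewrite negb_and => /orP[] /sin4_even ->;
       rewrite ?mul0r ?mulr0.
rewrite addr0 -[RHS]big_filter.
set s2 := (X in (_ = \sum_(t <- X) _)%R).
pose h (t : quad) : quad := (2 * qx t + 1, 2 * qy t + 1, qa t, qb t).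
pose g (t : quad) : quad := (qx t, qy t, (qa t)./2, (qb t)./2).
rewrite -(@big_seq_bij _ _ [seq t <- box n.+1 | P t] s2 h g).
- by apply: eq_bigr => t _; rewrite /F exprD !sin4_double_odd.
- exact/filter_uniq/box_uniq.
- exact/filter_uniq/sols_uniq.
- move=> [[[x y] r1] r2]; rewrite mem_filter mem_filter_sols /P /h /g /sol.
  rewrite /odd_two_size_partition /qa /qb /qx /qy /=.
  case/andP=> /and3P[x0 xy /eqP def_n] _; split.
    by apply/andP; split; lia.
  by congr (_, _, _, _); lia.
- move=> [[[a' b] x] y]; rewrite mem_filter_sols mem_filter mem_box.
  rewrite /P /h /g /sol /qa /qb /qx /qy /=.
  case/andP=> /and3P[xy oa ob] /and5P[a0 b0 x0 y0 /eqP def_n].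
  have Ea : 2 * a'./2 + 1 = a' by lia.
  have Eb : 2 * b./2 + 1 = b by lia.
  have odd2 : odd_two_size_partition n x y a'./2 b./2.
    by apply/and3P; split=> //; rewrite Ea Eb def_n.
  rewrite odd2 Ea Eb; split=> //=; apply/and4P.
  exact: odd_two_size_partition_bounded odd2.
Qed.

(** By the swap symmetry, 4 a(n) is twice the sum over all solutions minus twice that over x = y.
    After the bijections, the off-diagonal terms are twice the sum of [cos4 (qa t)] over x < y minus
    twice that over b < a. *)
Lemma a_diagonals (n : nat) :
  (4 * a n = \sum_(t <- sols n | qa t == qb t) (1 + 2 * cos4 (qa t))
   - \sum_(t <- sols n | qx t == qy t)
       (2 * cos4 (qa t) + cos4_diff (qa t) (qb t)))%R.
Proof.
have swap_sin :
    (\sum_(t <- sols n | (qy t < qx t)%N) sin4 (qa t) * sin4 (qb t) =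
    \sum_(t <- sols n | (qx t < qy t)%N) sin4 (qa t) * sin4 (qb t))%R.
  rewrite -[RHS]sum_sols_swap; apply: eq_big => -[[[a' b] x] y] //= _.
  exact: mulrC.
have swap_add : (\sum_(t <- sols n | (qy t < qx t)%N) cos4 (qa t + qb t) =
    \sum_(t <- sols n | (qx t < qy t)%N) cos4 (qa t + qb t))%R.
  rewrite -[RHS]sum_sols_swap; apply: eq_big => -[[[a' b] x] y] //= _.
  by rewrite addnC.
have swap_diff : (\sum_(t <- sols n | (qa t < qb t)%N) cos4_diff (qa t) (qb t) =
    \sum_(t <- sols n | (qb t < qa t)%N) cos4_diff (qa t) (qb t))%R.
  rewrite -[RHS]sum_sols_swap; apply: eq_big => -[[[a' b] x] y] //= _.
  by rewrite /cos4_diff addnC.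
have diff_lt : (\sum_(t <- sols n | (qb t < qa t)%N) cos4_diff (qa t) (qb t) =
    \sum_(t <- sols n | (qx t < qy t)%N) cos4 (qa t))%R.
  rewrite -liouville_sub; apply: eq_bigr => t lt_ba; congr cos4; lia.
have diff_eq : (\sum_(t <- sols n | qa t == qb t) cos4_diff (qa t) (qb t) =
    \sum_(t <- sols n | qa t == qb t) 1)%R.
  by apply: eq_bigr => t /eqP ->; rewrite /cos4_diff subnn.
have sinE (P : pred quad) :
    (2 * \sum_(t <- sols n | P t) sin4 (qa t) * sin4 (qb t) =
     \sum_(t <- sols n | P t) cos4_diff (qa t) (qb t)
     - \sum_(t <- sols n | P t) cos4 (qa t + qb t))%R.
  by rewrite mulr_sumr -sumrB; apply: eq_bigr => t _; exact: cos4_diff_add.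
(* Splitting the full sum of [cos4 (qa t)] both by a, b and by x, y, and cancelling the parts
   matched by the shear, turns the remaining off-diagonal difference into a difference of diagonal
   sums. *)
have := sum_trichotomy (sols n) qa qb (fun t => cos4 (qa t)).
rewrite (sum_trichotomy (sols n) qx qy (fun t => cos4 (qa t))) liouville_shear.
have := sum_trichotomy (sols n) qa qb (fun t => cos4_diff (qa t) (qb t)).
have := sum_trichotomy (sols n) qx qy (fun t => cos4 (qa t + qb t)).
have := sum_trichotomy (sols n) qx qy (fun t => sin4 (qa t) * sin4 (qb t))%R.
have := sinE predT; have := sinE (fun t => qx t == qy t).
rewrite swap_sin swap_add swap_diff diff_lt diff_eq liouville_add -a_sum_sols.
rewrite !big_split /= -!mulr_sumr.
move: (\sum_(t <- sols n) cos4_diff (qa t) (qb t))%R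
  (\sum_(t <- sols n) cos4 (qa t + qb t))%R
  (\sum_(t <- sols n) sin4 (qa t) * sin4 (qb t))%R
  (\sum_(t <- sols n | qx t == qy t) cos4_diff (qa t) (qb t))%R
  (\sum_(t <- sols n | qx t == qy t) cos4 (qa t + qb t))%R
  (\sum_(t <- sols n | qx t == qy t) sin4 (qa t) * sin4 (qb t))%R
  (\sum_(t <- sols n | qx t == qy t) cos4 (qa t))%R
  (\sum_(t <- sols n | qa t == qb t) 1)%R
  (\sum_(t <- sols n | qa t == qb t) cos4 (qa t))%R => A B C D E F G H I.
lia.
Qed.

(** * The diagonals as divisor sums *)

Lemma quotient_gt0 (n d : nat) : 0 < n -> d %| n -> 0 < n %/ d.
Proof.
by move=> n0 dn; rewrite divn_gt0; [exact: dvdn_leq | exact: dvdn_gt0 dn].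
Qed.

(** If a = b = d, then d (x + y) = n, and x runs over 1, ..., n / d - 1. *)
Lemma sum_diag_coef (n : nat) (f : nat -> int) : 0 < n ->
  (\sum_(t <- sols n | qa t == qb t) f (qa t) =
   \sum_(d <- divisors n) (n %/ d - 1)%N%:Z * f d)%R.
Proof.
move=> n0.
pose s := [seq (d, x) | d <- divisors n, x <- iota 1 (n %/ d - 1)].
transitivity (\sum_(p <- s) f p.1)%R.
  rewrite -[LHS]big_filter.
  apply: (@big_seq_bij _ _ _ _ (fun t : quad => (qa t, qx t))
    (fun p => (p.1, p.1, p.2, n %/ p.1 - p.2)) (fun p => f p.1)).
  - exact/filter_uniq/sols_uniq.
  - apply: allpairs_uniq_dep; first exact: divisors_uniq.
      by move=> d _; exact: iota_uniq.
    by move=> [d x] [d' x'] _ _ [-> ->].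
  - move=> [[[d b] x] y]; rewrite mem_filter_sols /qa /qb /qx /=.
    case/andP=> /eqP <- /and5P[d0 _ x0 y0 /eqP def_n].
    have nd : n %/ d = x + y by rewrite -def_n -mulnDr mulKn.
    split; last by rewrite nd addKn.
    apply/allpairsPdep; exists d, x; split=> //.
      by rewrite -dvdn_divisors // -def_n -mulnDr dvdn_mulr.
    by rewrite mem_iota nd; lia.
  - move=> _ /allpairsPdep[d [x [dn xd ->]]].
    move: dn xd; rewrite -dvdn_divisors // mem_iota mem_filter_sols /qa /qb.
    move=> dn xd; rewrite /= eqxx; split=> //.
    have d0 : 0 < d by exact: dvdn_gt0 dn.
    have Hn := divnK dn; by apply/and5P; split=> //; lia.
rewrite big_allpairs_dep /=; apply: eq_bigr => d _.
by rewrite big_const_seq count_predT size_iota iter_addr_0 pmulrn -mulrzl intz.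
Qed.

(** If x = y, then d = a + b divides n with quotient x, and a runs over 1, ..., d - 1. *)
Lemma sum_diag_mult (n : nat) (f : nat -> nat -> int) : 0 < n ->
  (\sum_(t <- sols n | qx t == qy t) f (qa t) (qb t) =
   \sum_(d <- divisors n) \sum_(1 <= l < d) f l (d - l)%N)%R.
Proof.
move=> n0.
pose s := [seq (d, l) | d <- divisors n, l <- index_iota 1 d].
transitivity (\sum_(p <- s) f p.2 (p.1 - p.2)%N)%R; last first.
  by rewrite big_allpairs_dep.
rewrite -[LHS]big_filter.
rewrite -(@big_seq_bij _ _ [seq t <- sols n | qx t == qy t] s
  (fun t : quad => (qa t + qb t, qa t))
  (fun p => (p.2, p.1 - p.2, n %/ p.1, n %/ p.1))
  (fun p => f p.2 (p.1 - p.2)%N)).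
- by apply: eq_bigr => t _; rewrite /= addKn.
- exact/filter_uniq/sols_uniq.
- apply: allpairs_uniq_dep; first exact: divisors_uniq.
    by move=> d _; exact: iota_uniq.
  by move=> [d x] [d' x'] _ _ [-> ->].
- move=> [[[a' b] x] y]; rewrite mem_filter_sols /qa /qb /qx /qy /=.
  case/andP=> /eqP <- /and5P[a0 b0 x0 _ /eqP def_n].
  have nd : n %/ (a' + b) = x by rewrite -def_n -mulnDl mulKn //; lia.
  split; last by rewrite nd addKn.
  apply/allpairsPdep; exists (a' + b), a'; split=> //.
    by rewrite -dvdn_divisors // -def_n -mulnDl dvdn_mulr.
  by rewrite mem_index_iota; lia.
- move=> _ /allpairsPdep[d [l [dn ld ->]]].
  move: dn ld; rewrite -dvdn_divisors // mem_index_iota mem_filter_sols.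
  rewrite /qa /qb /qx /qy /= eqxx => dn ld.
  have d0 : 0 < d by exact: dvdn_gt0 dn.
  have nd0 := quotient_gt0 n0 dn.
  have Hn := divnK dn; split; last by rewrite subnKC //; lia.
  by apply/and5P; split=> //; lia.
Qed.

(** The right side telescopes: a quarter turn sends sine to cosine and cosine to minus sine. *)
Lemma sum_cos4 (d : nat) :
  (2 * \sum_(1 <= l < d.+1) cos4 l = sin4 d.+1 - 1 - cos4 d.+1)%R.
Proof.
elim: d => [|d IHd]; first by rewrite big_nil.
rewrite big_nat_recr //= mulrDr IHd /sin4 /cos4.
have -> : d.+2 %% 4 = (d.+1 %% 4).+1 %% 4 by lia.
have := ltn_pmod d.+1 (isT : 0 < 4).
by case: (d.+1 %% 4) => [|[|[|[|]]]].
Qed.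

(** Up to sign the argument is d - 2 l, that is, the angle of d moved by l half turns. *)
Lemma cos4_diff_complement (l d : nat) :
  l <= d -> cos4_diff l (d - l) = ((-1) ^+ l * cos4 d)%R.
Proof.
move=> le_ld; rewrite -signr_odd /cos4_diff /cos4; move def_m : (_ + _)%N => m.
have := ltn_pmod d (isT : 0 < 4).
case: (boolP (odd l)) => odd_l.
  have [->|->] : m %% 4 = (2 + d %% 4) %% 4 \/ m %% 4 = (6 - d %% 4) %% 4 by lia.
    by case: (d %% 4) => [|[|[|[|]]]].
  by case: (d %% 4) => [|[|[|[|]]]].
have [->|->] : m %% 4 = d %% 4 \/ m %% 4 = (4 - d %% 4) %% 4 by lia.
  by case: (d %% 4) => [|[|[|[|]]]].
by case: (d %% 4) => [|[|[|[|]]]].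
Qed.

Lemma sum_sign (d : nat) :
  (\sum_(1 <= l < d.+1) (-1) ^+ l = - (odd d : nat)%:Z :> int)%R.
Proof.
elim: d => [|d IHd]; first by rewrite big_nil.
by rewrite big_nat_recr //= IHd -signr_odd /=; case: (odd d).
Qed.

(** For odd d both sides vanish with [cos4 d]; for even d the signs over 1, ..., d - 1 sum to -1. *)
Lemma sum_cos4_diff (d : nat) : 0 < d ->
  (\sum_(1 <= l < d) cos4_diff l (d - l) = - cos4 d)%R.
Proof.
case: d => // d _.
transitivity (\sum_(1 <= l < d.+1) (-1) ^+ l * cos4 d.+1)%R.
  by apply: eq_big_nat => l ld; apply: cos4_diff_complement; lia.
rewrite -mulr_suml sum_sign; case: (boolP (odd d)) => odd_d.
  by rewrite mulN1r.
by rewrite cos4_odd //= ?mulr0 ?oppr0.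
Qed.

Lemma a_divisor_sum (n : nat) : 0 < n ->
  (4 * a n =
   \sum_(d <- divisors n) ((n %/ d)%N%:Z * (1 + 2 * cos4 d) - sin4 d))%R.
Proof.
move=> n0; rewrite a_diagonals (sum_diag_coef (fun d => 1 + 2 * cos4 d)%R n0).
rewrite (sum_diag_mult (fun u v => 2 * cos4 u + cos4_diff u v)%R n0) -sumrB.
rewrite big_seq [RHS]big_seq; apply: eq_bigr => d.
rewrite -dvdn_divisors // => dn.
have d0 : 0 < d by exact: dvdn_gt0 dn.
have nd0 := quotient_gt0 n0 dn.
rewrite big_split /= sum_cos4_diff // -mulr_sumr -(prednK d0) sum_cos4.
rewrite prednK // -subzn // mulrBl mul1r.
(* With the product of n / d and 1 + 2 [cos4 d] made opaque, the identity is linear. *)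
move: (_ * _)%R => A; lia.
Qed.

(** * Lower bounds from the divisor sum *)

Lemma divisor_term_ge0 (m d : nat) : 0 < m -> (0 <= m%:Z - sin4 d)%R.
Proof. by move=> m0; rewrite subr_ge0 (le_trans (sin4_le1 d)). Qed.

Lemma le_term_sum (s : seq nat) (P : pred nat) (F : nat -> int) (i : nat) :
    i \in s -> P i -> {in s, forall j, P j -> 0 <= F j}%R ->
  (F i <= \sum_(j <- s | P j) F j)%R.
Proof.
move=> si Pi F0; rewrite (big_rem i) //= Pi lerDl big_seq_cond.
by apply: sumr_ge0 => j /andP[/mem_rem sj Pj]; exact: F0.
Qed.

(** For even n, an odd d divides n exactly when 2 d does. *)
Lemma sum_divisors_twice_odd (n : nat) (F : nat -> int) : 0 < n -> ~~ odd n ->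
  (\sum_(d <- divisors n | (d %% 4 == 2)%N) F d =
   \sum_(d <- divisors n | odd d) F (2 * d)%N)%R.
Proof.
move=> n0 even_n; rewrite -[LHS]big_filter -[RHS]big_filter; symmetry.
apply: (@big_seq_bij _ _ _ _ (fun d => 2 * d) (fun d => d./2)).
- exact/filter_uniq/divisors_uniq.
- exact/filter_uniq/divisors_uniq.
- move=> d; rewrite !mem_filter -!dvdn_divisors // => /andP[odd_d dn].
  split; last by lia.
  apply/andP; split; first by lia.
  by rewrite Gauss_dvd ?coprime2n // dvdn2 even_n.
- move=> d; rewrite !mem_filter -!dvdn_divisors // => /andP[/eqP d2 dn].
  have def_d : 2 * d./2 = d by lia.
  split; last by [].
  apply/andP; split; first by lia.
  by apply: dvdn_trans dn; apply/dvdnP; exists 2.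
Qed.

(** All divisors are odd, so each term is n / d - [sin4 d], which is nonnegative; d = 1 gives n -
    1. *)
Lemma a_lower_bound_odd (n : nat) : odd n -> (n%:Z - 1 <= 4 * a n)%R.
Proof.
move=> odd_n; have n0 : 0 < n by case: n odd_n.
rewrite a_divisor_sum // big_seq.
rewrite (eq_bigr (fun d => (n %/ d)%N%:Z - sin4 d)%R); last first.
  move=> d; rewrite -dvdn_divisors // => dn.
  by rewrite (cos4_odd (dvdn_odd dn odd_n)) mulr0 addr0 mulr1.
rewrite -big_seq -{1}(divn1 n).
apply: (@le_term_sum _ predT (fun d => (n %/ d)%N%:Z - sin4 d)%R 1) => //.
  by rewrite -dvdn_divisors.
move=> d; rewrite -dvdn_divisors // => dn _; apply: divisor_term_ge0.
exact: quotient_gt0.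
Qed.

(** The terms of an odd d and of 2 d add up to n / (2 d) - [sin4 d], which is nonnegative; d = 1
    gives n / 2 - 1. *)
Lemma a_lower_bound_even (n : nat) :
  0 < n -> ~~ odd n -> ((n %/ 2)%N%:Z - 1 <= 4 * a n)%R.
Proof.
move=> n0 even_n; rewrite a_divisor_sum // (bigID odd) /=.
rewrite [X in (_ <= _ + X)%R](bigID (fun d => d %% 4 == 2)) /= addrA.
(* [low] collects the divisors divisible by 4, whose terms are 3 n / d. *)
set low := (X in (_ <= _ + X)%R).
have low0 : (0 <= low)%R.
  apply: sumr_ge0 => d /andP[even_d d2]; rewrite sin4_even // subr0.
  by rewrite /cos4 (_ : d %% 4 = 0) //; lia.
apply: (@le_trans _ _ (\sum_(d <- divisors n | odd d)
  ((n %/ (2 * d))%N%:Z - sin4 d))%R); last first.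
  rewrite -[leLHS]addr0 lerD //.
  rewrite [X in (_ <= _ + X)%R](eq_bigl (fun d => d %% 4 == 2));
    last by move=> d; lia.
  rewrite sum_divisors_twice_odd // -big_split /= big_seq_cond.
  rewrite [leRHS]big_seq_cond; apply: ler_sum => d.
  rewrite -dvdn_divisors // => /andP[dn odd_d].
  have d2n : 2 * d %| n by rewrite Gauss_dvd ?coprime2n // dvdn2 even_n.
  have -> : n %/ d = 2 * (n %/ (2 * d)).
    have d0 := dvdn_gt0 n0 dn.
    by rewrite -{1}(divnK d2n) mulnA mulnK // mulnC.
  rewrite cos4_odd // (sin4_even (k := 2 * d)); last by lia.
  by rewrite /cos4 (_ : (2 * d) %% 4 = 2) /=; lia.
rewrite -[X in n %/ X]muln1.
apply: (@le_term_sum _ odd (fun d => (n %/ (2 * d))%N%:Z - sin4 d)%R 1) => //.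
  by rewrite -dvdn_divisors.
move=> d; rewrite -dvdn_divisors // => dn odd_d; apply: divisor_term_ge0.
have d2n : 2 * d %| n by rewrite Gauss_dvd ?coprime2n // dvdn2 even_n.
exact: quotient_gt0.
Qed.

Theorem corollary1p2 (n : nat) (n_gt0 : 0 < n) :
  (0 <= a n)%R /\ (a n = 0%R <-> n = 1 \/ n = 2).
Proof.
(* At n = 1 and n = 2 the lower bounds are 0, so the vanishing is computed from the exact formula;
   for larger n the bounds are positive. *)
have a1 : a 1 = 0%R.
  by have := a_divisor_sum (isT : 0 < 1); rewrite big_seq1 /sin4 /cos4 /=; lia.
have a2 : a 2 = 0%R.
  by have := a_divisor_sum (isT : 0 < 2);
    rewrite big_cons big_seq1 /sin4 /cos4 /=; lia.
have [odd_n | even_n] := boolP (odd n).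
  have := a_lower_bound_odd odd_n; split; first by lia.
  by split=> [|[->|->]] //; lia.
have := a_lower_bound_even n_gt0 even_n; split; first by lia.
by split=> [|[->|->]] //; lia.
Qed.
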